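(* Let $X$ be a set, $F$ a field, $d\in\mathbb{N}$ with $d\ge 2$, and $\overline{f}:X\to F^d$. Then the following are equivalent: (1) $\mathcal{C}_{\overline{f}}$ is maximal of VC-dimension $d-1$; (2) $\overline{f}(X)$ is not contained in a finite union of proper subspaces of $F^d$.
   Context: Notation: $\mathbb{N}$ includes $0$; $[n]=\{k\in\mathbb{N}: 0\le k<n\}$; ${}^{A}B$ is the set of functions from $A$ to $B$; $\mathcal{P}(X)$ is the power set of $X$; $\binom{n}{\le m}=\sum_{i=0}^{m}\binom{n}{i}$. Zero sets: for $\overline{a},\overline{b}\in F^d$, $\overline{a}\cdot\overline{b}=\sum_{i=0}^{d-1}a_ib_i$. For $\overline{f}:X\to F^d$ and $\overline{a}\in F^d$, let $Z_{\overline{f},\overline{a}}=\{c\in X:\overline{a}\cdot\overline{f}(c)=0\}$ and $\mathcal{C}_{\overline{f}}=\{Z_{\overline{f},\overline{a}}:\overline{a}\in F^d\setminus\{\overline{0}\}\}\subseteq\mathcal{P}(X)$. Trees: let $\mathcal{C}\subseteq\mathcal{P}(X)$ and $n\in\mathbb{N}$. An $(X,\mathcal{C})$-labeled tree of depth $n$ is a function $T:\bigcup_{k\le n}{}^{[k]}[2]\to X\cup\mathcal{C}$ such that $T(\sigma)\in X$ for all $\sigma\in{}^{[k]}[2]$ with $0\le k<n$, and $T(\tau)\in\mathcal{C}$ for all $\tau\in{}^{[n]}[2]$. For $\tau\in{}^{[n]}[2]$, the leaf $(\tau,T(\tau))$ is well-labeled if for all $0\le k<n$: $T(\tau|_{[k]})\in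 T(\tau)\iff\tau(k)=1$. $T$ is level-balanced if $T(\sigma_0)=T(\sigma_1)$ for all $k<n$ and all $\sigma_0,\sigma_1\in{}^{[k]}[2]$. VC-shatter function: $\pi_{\mathcal{C}}(n)$ is the maximum number of well-labeled leaves of a level-balanced $(X,\mathcal{C})$-labeled tree of depth $n$; equivalently (when $X$ has an $n$-element subset), $\pi_{\mathcal{C}}(n)=\max\{|\{A\cap Y:A\in\mathcal{C}\}| : Y\subseteq X, |Y|=n\}$. Maximality: for $m\in\mathbb{N}$, $\mathcal{C}$ is maximal of VC-dimension $m$ if $\pi_{\mathcal{C}}(n)=\binom{n}{\le m}$ for all $n\ge m$. *)

(* Defs.v *)
From HB Require Import structures.
From mathcomp Require Import all_boot all_order all_algebra.
From mathcomp Require Import boolp classical_sets.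

Set Implicit Arguments.
Unset Strict Implicit.
Unset Printing Implicit Defensive.

Import GRing.Theory.
Local Open Scope ring_scope.
Local Open Scope classical_set_scope.

Definition dotv (F : fieldType) (d : nat) (a b : 'rV[F]_d) : F :=
  \sum_(i < d) a 0 i * b 0 i.

Definition zero_set (X : Type) (F : fieldType) (d : nat)
    (f : X -> 'rV[F]_d) (a : 'rV[F]_d) : set X :=
  [set c | dotv a (f c) = 0].

Definition zero_sets (X : Type) (F : fieldType) (d : nat)
    (f : X -> 'rV[F]_d) : set (set X) :=
  [set Z | exists2 a : 'rV[F]_d, a != 0 & Z = zero_set f a].

(* The single labeling function on all binary strings of length <= n is split
   into its restrictions to strings of length < n (labels in X) and to strings
   of length n (labels in C). For n = 0 the first one has empty domain, so
   trees of depth 0 exist even when X is empty. *)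
Record labeled_tree (X : Type) (C : set (set X)) (n : nat) := LabeledTree {
  node : forall k : 'I_n, {ffun 'I_k -> bool} -> X;
  leaf : {ffun 'I_n -> bool} -> set X;
  leaf_in : forall tau, C (leaf tau)
}.

Definition string_prefix (n : nat) (tau : {ffun 'I_n -> bool}) (k : 'I_n) :
    {ffun 'I_k -> bool} :=
  [ffun i => tau (widen_ord (ltnW (ltn_ord k)) i)].

Definition well_labeled (X : Type) (C : set (set X)) (n : nat)
    (T : labeled_tree C n) (tau : {ffun 'I_n -> bool}) : Prop :=
  forall k : 'I_n, leaf T tau (node T (string_prefix tau k)) <-> tau k = true.

Definition level_balanced (X : Type) (C : set (set X)) (n : nat)
    (T : labeled_tree C n) : Prop :=
  forall (k : 'I_n) (s0 s1 : {ffun 'I_k -> bool}), node T s0 = node T s1.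

Definition num_well_labeled (X : Type) (C : set (set X)) (n : nat)
    (T : labeled_tree C n) : nat :=
  #|[pred tau : {ffun 'I_n -> bool} | `[< well_labeled T tau >]]|.

(* The bound on m is the total number of leaves, so it excludes no tree. The
   value is 0 when there is no level-balanced tree at all, i.e. when C is
   empty, or X is empty and n > 0. *)
Definition vc_shatter (X : Type) (C : set (set X)) (n : nat) : nat :=
  \max_(m < #|{: {ffun 'I_n -> bool}}|.+1 |
        `[< exists T : labeled_tree C n,
              level_balanced T /\ num_well_labeled T = m >]) m.

Definition binom_le (n m : nat) : nat := (\sum_(0 <= i < m.+1) 'C(n, i))%N.

Definition maximal_of_VC_dim (X : Type) (C : set (set X)) (m : nat) : Prop :=
  forall n : nat, (m <= n)%N -> vc_shatter C n = binom_le n m.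

Definition in_finite_union_of_proper_subspaces (X : Type) (F : fieldType)
    (d : nat) (f : X -> 'rV[F]_d) : Prop :=
  exists s : seq {vspace 'rV[F]_d},
    (forall U, U \in s -> U != fullv) /\
    range f `<=` [set v | exists2 U, U \in s & v \in U].

(* Main.v *)
(* Write v_k = f(y_k) for points y_0, ..., y_(n-1) of X. The traces on the y_k
   are the sets {k : a.v_k = 0} with a <> 0. Each is a flat of the vector
   matroid of v of rank less than d, so it is the closure of an independent set
   of fewer than d indices: there are at most binom(n, <= d-1) traces. If f(X)
   is not covered by finitely many proper subspaces, F is infinite and the v_k
   can be chosen with any d of them independent; every set of fewer than d
   indices is then a trace. If f(X) is covered by r proper subspaces and n > r d,
   some d of the v_k lie in one of these subspaces, and two sets of fewer than d
   indices have the same closure or one of them is dependent: the bound is never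
   attained. *)
Require Import Defs.
From mathcomp Require Import all_boot all_order all_algebra.
From mathcomp Require Import boolp classical_sets.
From mathcomp Require Import finset zify.

Set Implicit Arguments.
Unset Strict Implicit.
Unset Printing Implicit Defensive.

Import GRing.Theory.
Local Open Scope ring_scope.

(** * Counting small sets; orthogonality as a matrix equation *)

Lemma card_set_lt (T : finType) (m : nat) :
  #|[set B : {set T} | #|B| < m]%N| = (\sum_(0 <= i < m) 'C(#|T|, i))%N.
Proof.
elim: m => [|m IHm]; first by rewrite big_nil; apply: eq_card0 => B; rewrite inE.
rewrite big_nat_recr //= -IHm -card_draws -cardsUI.
rewrite [X in (_ + X)%N](_ : _ = 0%N); last first.
  by apply: eq_card0 => B; rewrite !inE; case: ltngtP.
by rewrite addn0; apply: eq_card => B; rewrite !inE ltnS leq_eqVlt orbC.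
Qed.

Lemma dotv_mul (F : fieldType) (d : nat) (a b : 'rV[F]_d) :
  (dotv a b = 0) <-> (b *m a^T = 0).
Proof.
have -> : b *m a^T = (dotv a b)%:M.
  apply/matrixP => i j; rewrite !ord1 !mxE eqxx mulr1n /dotv.
  by apply: eq_bigr => k _; rewrite mxE mulrC.
split=> [-> | /matrixP/(_ 0 0)]; first exact: raddf0.
by rewrite !mxE eqxx.
Qed.

(** * The vector matroid of a finite family *)

(** [<<v k>>] is a square matrix with the same row space as [v k], so the iterated sum stays in one
    type. *)
Definition vspan (F : fieldType) (d n : nat) (v : 'I_n -> 'rV[F]_d)
  (B : {set 'I_n}) : 'M[F]_d := (\sum_(k in B) <<v k>>)%MS.

Definition flat (F : fieldType) (d n : nat) (v : 'I_n -> 'rV[F]_d)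
  (B : {set 'I_n}) : {set 'I_n} := [set k | (v k <= vspan v B)%MS].

Definition indep (F : fieldType) (d n : nat) (v : 'I_n -> 'rV[F]_d)
  (B : {set 'I_n}) : bool := \rank (vspan v B) == #|B|.

(** Traces are recorded as sets of indices, so that repeated vectors are allowed. *)
Definition zero_patterns (F : fieldType) (d n : nat) (v : 'I_n -> 'rV[F]_d) :
    {set {set 'I_n}} :=
  [set S : {set 'I_n} | `[< exists2 a : 'rV[F]_d, a != 0 &
                 forall k, dotv a (v k) = 0 <-> k \in S >]].

Lemma vspan_sub (F : fieldType) (d n m : nat) (v : 'I_n -> 'rV[F]_d)
    (B : {set 'I_n}) (A : 'M[F]_(m, d)) :
  reflect (forall k, k \in B -> (v k <= A)%MS) (vspan v B <= A)%MS.
Proof.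
by apply: (iffP sumsmx_subP) => H k /H; rewrite genmxE.
Qed.

Lemma mem_vspan (F : fieldType) (d n : nat) (v : 'I_n -> 'rV[F]_d)
    (B : {set 'I_n}) (k : 'I_n) : k \in B -> (v k <= vspan v B)%MS.
Proof. by move: k; apply/vspan_sub. Qed.

Lemma vspanU1 (F : fieldType) (d n : nat) (v : 'I_n -> 'rV[F]_d)
    (B : {set 'I_n}) (k : 'I_n) :
  (vspan v (k |: B) :=: v k + vspan v B)%MS.
Proof.
apply/eqmxP/andP; split.
  apply/vspan_sub => l; rewrite !inE => /orP[/eqP->|lB]; first exact: addsmxSl.
  exact: submx_trans (mem_vspan v lB) (addsmxSr _ _).
rewrite addsmx_sub mem_vspan ?setU11 //=.
by apply/vspan_sub => l lB; rewrite mem_vspan // setU1r.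
Qed.

Lemma rank_vspan (F : fieldType) (d n : nat) (v : 'I_n -> 'rV[F]_d)
    (B : {set 'I_n}) : (\rank (vspan v B) <= #|B|)%N.
Proof.
rewrite -sum1_card /vspan.
apply: (big_ind2 (fun (A : 'M[F]_d) m => (\rank A <= m)%N)) => [|A1 m1 A2 m2 h1 h2|k _].
- by rewrite mxrank0.
- by apply: leq_trans (mxrank_adds_leqif _ _) _; rewrite leq_add.
- by rewrite mxrank_gen rank_leq_row.
Qed.

Lemma indepU1 (F : fieldType) (d n : nat) (v : 'I_n -> 'rV[F]_d)
    (B : {set 'I_n}) (k : 'I_n) :
  indep v B -> ~~ (v k <= vspan v B)%MS -> indep v (k |: B).
Proof.
move=> /eqP indB kB; have kNB : k \notin B by apply: contra kB => /mem_vspan.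
rewrite /indep eqn_leq rank_vspan cardsU1 kNB add1n -indB vspanU1 /=.
apply: rank_ltmx; rewrite ltmxE addsmxSr /=.
by apply: contra kB => /(submx_trans (addsmxSl _ _)).
Qed.

(** An independent subset of [S] of maximum size works: a vector of [S] outside its span could still
    be added. *)
Lemma ex_indep_vspan (F : fieldType) (d n : nat) (v : 'I_n -> 'rV[F]_d)
    (S : {set 'I_n}) :
  exists2 B : {set 'I_n}, B \subset S & indep v B /\ (vspan v S <= vspan v B)%MS.
Proof.
have P0 : (set0 \subset S) && indep v set0.
  by rewrite sub0set /indep /vspan big_set0 mxrank0 cards0.
case: (@arg_maxnP _ set0 (fun B => (B \subset S) && indep v B) (fun B => #|B|) P0).
move=> B /andP[BS indB] maxB; exists B => //; split=> //.
apply/vspan_sub => k kS; apply: contraT => kB.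
have := maxB (k |: B); rewrite subUset sub1set kS BS (indepU1 indB kB) => /(_ isT).
have -> : #|k |: B| = #|B|.+1.
  by rewrite cardsU1 (contra (@mem_vspan _ _ _ v B k) kB).
by rewrite /= ltnn.
Qed.

(** * Upper bounds on the number of zero patterns *)

(** A basis [B] of [S] spans a subspace of the hyperplane orthogonal to [a]; this bounds its size,
    and no index outside [S] can enter its flat. *)
Lemma zero_pattern_flat (F : fieldType) (d n : nat) (v : 'I_n -> 'rV[F]_d)
    (S : {set 'I_n}) : S \in zero_patterns v ->
  exists2 B : {set 'I_n}, S = flat v B & indep v B /\ (#|B| < d)%N.
Proof.
rewrite inE => /asboolP[a a0 aS].
have kerS k : (v k <= kermx a^T)%MS = (k \in S).
  by apply/sub_kermxP/idP => [/dotv_mul/aS|/aS/dotv_mul].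
have [B BS [indB SB]] := ex_indep_vspan v S.
have Sker : (vspan v S <= kermx a^T)%MS by apply/vspan_sub => k; rewrite kerS.
have Bker : (vspan v B <= kermx a^T)%MS.
  by apply/vspan_sub => k /(fintype.subsetP BS); rewrite kerS.
exists B; last split=> //.
  apply/setP => k; rewrite inE; apply/idP/idP => [kS|kB].
    exact: submx_trans (mem_vspan v kS) SB.
  by rewrite -kerS (submx_trans kB).
rewrite -(eqP indB); apply: leq_ltn_trans (mxrankS Bker) _.
rewrite mxrank_ker mxrank_tr rank_rV a0.
(* A nonzero row forces [d > 0], so the truncated [d - 1] is below [d]. *)
by have := rank_leq_col a; rewrite rank_rV a0; lia.
Qed.

(** [P] is left arbitrary: all small sets give the binomial bound, all but one give the strict
    bound. *)
Lemma card_zero_patterns_le (F : fieldType) (d n : nat) (v : 'I_n -> 'rV[F]_d)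
    (P : {set {set 'I_n}}) :
  (forall B, indep v B -> (#|B| < d)%N -> exists2 B', B' \in P & flat v B = flat v B') ->
  (#|zero_patterns v| <= #|P|)%N.
Proof.
move=> coverP; apply: leq_trans (leq_imset_card (flat v) P).
apply/subset_leq_card/fintype.subsetP => S /zero_pattern_flat[B -> [indB Bd]].
by have [B' B'P ->] := coverP B indB Bd; apply: imset_f.
Qed.


(* If all the sets D :\ i are independent, they all span A and have the same
   flat; otherwise a dependent D :\ i is not needed to generate flats. *)
Lemma card_zero_patterns_lt (F : fieldType) (d n : nat) (v : 'I_n -> 'rV[F]_d)
    (D : {set 'I_n}) (A : 'M[F]_d) :
  (2 <= d)%N -> #|D| = d -> (\rank A < d)%N ->
  (forall k, k \in D -> (v k <= A)%MS) ->
  (#|zero_patterns v| < #|[set B : {set 'I_n} | #|B| < d]%N|)%N.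
Proof.
move=> d2 Dd rA DA.
have cardD i : i \in D -> (#|D :\ i| = d.-1)%N.
  by move=> iD; move: Dd; rewrite (cardsD1 i D) iD => <-.
have ltD i : i \in D -> D :\ i \in [set B : {set 'I_n} | #|B| < d]%N.
  by move=> iD; rewrite inE cardD //; lia.
suff [l lD cover_l] : exists2 l, l \in D & forall B, indep v B -> (#|B| < d)%N ->
    exists2 B', B' \in [set B : {set 'I_n} | #|B| < d]%N :\ (D :\ l) & flat v B = flat v B'.
  rewrite [X in (_ < X)%N](cardsD1 (D :\ l)) ltD // add1n ltnS.
  exact: card_zero_patterns_le cover_l.
have [i iD] : exists i, i \in D by apply/card_gt0P; rewrite Dd; lia.
(* Here [2 <= d] matters: [D :\ j] is a second set, able to replace [D :\ i]. *)
have [j jD ji] : exists2 j, j \in D & j != i.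
  have /card_gt0P[j] : (0 < #|D :\ i|)%N by rewrite cardD //; lia.
  by rewrite !inE => /andP[ji jD]; exists j.
have [allD|] := boolP [forall i in D, indep v (D :\ i)].
  have flatD l : l \in D -> flat v (D :\ l) = [set k | (v k <= A)%MS].
    move=> lD; have lA : (vspan v (D :\ l) <= A)%MS.
      by apply/vspan_sub => k; rewrite !inE => /andP[_ /DA].
    have Al : (A <= vspan v (D :\ l))%MS.
      rewrite -(geq_leqif (mxrank_leqif_sup lA)).
      by move/forall_inP/(_ l lD)/eqP: allD => ->; rewrite cardD //; lia.
    apply/setP => k; rewrite !inE.
    by apply/idP/idP => /submx_trans; apply.
  exists i => // B indB Bd; have [->|Bi] := eqVneq B (D :\ i); last first.
    by exists B => //; rewrite !inE Bi.
  exists (D :\ j); last by rewrite !flatD.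
  rewrite !inE; have := ltD j jD; rewrite inE => ->; rewrite andbT.
  by apply/eqP => /setP/(_ i); rewrite !inE eqxx iD eq_sym ji.
case/forall_inPn => l lD /negP notind; exists l => // B indB Bd.
by exists B => //; rewrite !inE Bd andbT; apply/eqP => BE; apply: notind; rewrite -BE.
Qed.

(** * Finite covers, infinite fields and generic functionals *)

Lemma root_seq (F : fieldType) (p : {poly F}) :
  p != 0 -> exists s : seq F, forall x, root p x -> x \in s.
Proof.
have [m] := ubnP (size p); elim: m p => // m IHm p; rewrite ltnS => pm p0.
have [[x px]|noroot] := pselect (exists x, root p x); last first.
  by exists [::] => x px; case: noroot; exists x.
have /factor_theorem[q pq] := px.
have q0 : q != 0 by apply: contra_neq p0; rewrite pq => ->; rewrite mul0r.
have [|s sP] := IHm q _ q0.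
  by move: pm; rewrite pq size_Mmonic ?monicXsubC // size_XsubC addn2.
exists (x :: s) => y; rewrite pq rootM root_XsubC inE => /orP[/sP ->|->//].
by rewrite orbT.
Qed.

(** [U] is the row space of the matrix of its projection; conversely, the row space of [A] is the
    kernel of multiplication by [cokermx A]. *)
Lemma in_finite_unionP (X : Type) (F : fieldType) (d : nat) (f : X -> 'rV[F]_d) :
  in_finite_union_of_proper_subspaces f <->
  exists s : seq 'M[F]_d, (forall A, A \in s -> (\rank A < d)%N) /\
                          (forall x, exists2 A, A \in s & (f x <= A)%MS).
Proof.
split=> [[s [properS fs]]|[s [properS fs]]].
  exists [seq lin1_mx (projv U) | U <- s]; split=> [A /mapP[U Us ->]|x].
    apply: contraR (properS U Us); rewrite -leqNgt => rA.
    apply/eqP/vspaceP => u; rewrite memvf.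
    have : (u <= lin1_mx (projv U))%MS.
      by apply: submx_full; rewrite /row_full eqn_leq rank_leq_col.
    by case/submxP => w ->; rewrite mul_rV_lin1 memv_proj.
  have [|U Us fU] := fs (f x); first by exists x.
  exists (lin1_mx (projv U)); first exact: map_f.
  by apply/submxP; exists (f x); rewrite mul_rV_lin1 /= projv_id.
have kerP (A : 'M[F]_d) u :
    (u \in lker (linfun (mulmxr (cokermx A) : 'rV_d -> 'rV_d))) = (u <= A)%MS.
  by rewrite memv_ker lfunE /= submxE.
exists [seq lker (linfun (mulmxr (cokermx A) : 'rV_d -> 'rV_d)) | A <- s].
split=> [U /mapP[A As ->]|_ [x _ <-]].
  apply/eqP => kerT; have := properS A As; rewrite ltnNge => /negP; apply.
  have : (1%:M <= A)%MS by apply/row_subP => i; rewrite -kerP kerT memvf.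
  by move/mxrankS; rewrite mxrank1.
have [A As fA] := fs x.
exists (lker (linfun (mulmxr (cokermx A) : 'rV_d -> 'rV_d))); last by rewrite kerP.
exact: (map_f (fun A => lker (linfun (mulmxr (cokermx A) : 'rV_d -> 'rV_d)))).
Qed.

(* Over a finite field, F^d is a finite union of hyperplanes x_0 = t x_1 or x_1 = 0. *)
Lemma ex_nonroot (X : Type) (F : fieldType) (d : nat) (f : X -> 'rV[F]_d) (p : {poly F}) :
  (2 <= d)%N -> ~ in_finite_union_of_proper_subspaces f -> p != 0 ->
  exists t, ~~ root p t.
Proof.
move=> d2 finf p0; apply: contrapT => rootp; apply: finf.
have [s sP] := root_seq p0.
(* Were every scalar a root of [p], the list of its roots would exhaust [F]. *)
have s_all t : t \in s by apply/sP/negPn/negP => pt; apply: rootp; exists t.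
case: d d2 f => [//|[//|d]] _ f; apply/in_finite_unionP.
pose i1 : 'I_d.+2 := lift ord0 ord0.
pose c0 : 'cV[F]_d.+2 := delta_mx i1 0.
pose c t : 'cV[F]_d.+2 := delta_mx ord0 0 - t *: delta_mx i1 0.
exists [seq kermx c' | c' <- c0 :: [seq c t | t <- s]]; split.
  have rk (c' : 'cV[F]_d.+2) : c' != 0 -> (\rank (kermx c') < d.+2)%N.
    move=> c'0; rewrite mxrank_ker -mxrank_tr rank_rV trmx_eq0 c'0; lia.
  move=> A /mapP[c' c's ->]; apply: rk.
  move: c's; rewrite inE => /orP[/eqP->|/mapP[t _ ->]].
    by apply/eqP => /matrixP/(_ i1 0)/eqP; rewrite !mxE !eqxx oner_eq0.
  by apply/eqP => /matrixP/(_ ord0 0)/eqP; rewrite !mxE !eqxx /= mulr0 subr0 oner_eq0.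
move=> x; pose u := f x.
have uE (i : 'I_d.+2) : u *m delta_mx i 0 = (u 0 i)%:M :> 'M_1.
  by rewrite -colE; apply/matrixP => a b; rewrite !ord1 !mxE eqxx.
have [u1|u1] := eqVneq (u 0 i1) 0.
  exists (kermx c0); first by rewrite map_f // inE eqxx.
  by apply/sub_kermxP; rewrite uE u1 raddf0.
exists (kermx (c (u 0 ord0 / u 0 i1))).
  by rewrite map_f // inE map_f ?orbT.
by apply/sub_kermxP; rewrite mulmxBr -scalemxAr !uE scale_scalar_mx divfK // subrr.
Qed.

(* The columns of cokermx A span the dual of F^d / A; a generic point of the
   moment curve in this dual vanishes at no vector of s. *)
Lemma ex_orthogonal_avoiding (F : fieldType) (d : nat) (A : 'M[F]_d) (s : seq 'rV[F]_d) :
  (forall p : {poly F}, p != 0 -> exists t, ~~ root p t) ->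
  (forall u, u \in s -> ~~ (u <= A)%MS) ->
  exists a, (forall u, (u <= A)%MS -> dotv a u = 0) /\
            (forall u, u \in s -> dotv a u <> 0).
Proof.
move=> infF sA.
have [|t tP] := infF (\prod_(u <- s) rVpoly (u *m cokermx A)).
  rewrite prodf_seq_neq0; apply/allP => u /sA /=; rewrite submxE; apply: contra_neq => u0.
  by rewrite -[LHS]rVpolyK u0 raddf0.
(* The coordinates of [u] modulo [A] serve as coefficients; pairing them with the powers of [t] is
   evaluation at [t]. *)
have eval u : u *m (cokermx A *m \col_i t ^+ i) = ((rVpoly (u *m cokermx A)).[t])%:M.
  rewrite mulmxA (@horner_coef_wide _ d) ?size_poly //.
  apply/matrixP => i j; rewrite !ord1 !mxE eqxx mulr1n.
  by apply: eq_bigr => k _; rewrite coef_rVpoly_ord [X in _ * X = _]mxE.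
exists (cokermx A *m \col_i t ^+ i)^T; split=> u.
  move=> uA; apply/dotv_mul; rewrite trmxK mulmxA.
  by move: uA; rewrite submxE => /eqP->; rewrite mul0mx.
move=> us /dotv_mul; rewrite trmxK eval => /matrixP/(_ 0 0).
rewrite !mxE eqxx mulr1n => ut; move: tP; rewrite /root horner_prod.
by rewrite (big_rem u) //= ut mul0r eqxx.
Qed.

(** * Small sets as zero patterns, and points in general position *)

Lemma zero_patterns_general (F : fieldType) (d n : nat) (v : 'I_n -> 'rV[F]_d)
    (S : {set 'I_n}) :
  (forall p : {poly F}, p != 0 -> exists t, ~~ root p t) ->
  (forall B : {set 'I_n}, (#|B| <= d)%N -> indep v B) ->
  (#|S| < d)%N -> S \in zero_patterns v.
Proof.
move=> infF genv Sd.
have rS : (\rank (vspan v S) < d)%N := leq_ltn_trans (rank_vspan v S) Sd.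
have [i iS] : exists i, ~~ (row i (1%:M : 'M[F]_d) <= vspan v S)%MS.
  apply/row_subPn; apply: contraL rS => /mxrankS.
  by rewrite mxrank1 -leqNgt.
have [|a [aS aN]] := @ex_orthogonal_avoiding F d (vspan v S)
    (* The extra basis vector outside the span of [S] keeps [a] nonzero even when [S] contains every
       index. *)
    (row i 1%:M :: [seq v k | k <- enum (~: S)]) infF.
  move=> u; rewrite inE => /orP[/eqP-> //|/mapP[k]].
  rewrite mem_enum inE => kS ->; apply/negP => kspan.
  have /eqP : indep v (k |: S) by apply: genv; rewrite cardsU1 kS.
  rewrite cardsU1 kS add1n => rU.
  suff : (\rank (vspan v (k |: S)) <= #|S|)%N by rewrite rU ltnn.
  apply: leq_trans (rank_vspan v S); apply: mxrankS.
  by rewrite vspanU1 addsmx_sub kspan submx_refl.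
rewrite inE; apply/asboolP; exists a => [|k].
  apply/eqP => a0; apply: (aN (row i 1%:M)); first by rewrite inE eqxx.
  by rewrite a0; apply: big1 => j _; rewrite mxE mul0r.
split=> [ak|/(mem_vspan v)/aS //]; apply: contraT => kS.
by case: (aN (v k)) => //; rewrite inE map_f ?orbT // mem_enum inE.
Qed.

Lemma eq_vspan (F : fieldType) (d n : nat) (v w : 'I_n -> 'rV[F]_d)
    (B : {set 'I_n}) : {in B, v =1 w} -> vspan v B = vspan w B.
Proof. by move=> vw; apply: eq_bigr => k /vw ->. Qed.

(** Points are chosen one at a time, each avoiding the spans of all sets of fewer than [d] current
    vectors, which are finitely many proper subspaces. *)
Lemma ex_general_position (X : Type) (F : fieldType) (d : nat) (f : X -> 'rV[F]_d)
    (n : nat) : (0 < d)%N ->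
  ~ in_finite_union_of_proper_subspaces f ->
  exists y : 'I_n -> X,
    forall B : {set 'I_n}, (#|B| <= d)%N -> indep (f \o y) B.
Proof.
move=> d0 finf.
have avoid (s : seq 'M[F]_d) : (forall A, A \in s -> (\rank A < d)%N) ->
    exists x, forall A, A \in s -> ~~ (f x <= A)%MS.
  move=> rs; apply: contrapT => nox; apply: finf; apply/in_finite_unionP.
  exists s; split=> // x; apply: contrapT => noA; apply: nox; exists x => A As.
  by apply/negP => fA; apply: noA; exists A.
suff prefix m : exists y : 'I_n -> X, forall B : {set 'I_n},
    (forall k, k \in B -> (k < m)%N) -> (#|B| <= d)%N -> indep (f \o y) B.
  by have [y yP] := prefix n; exists y => B; apply: yP.
elim: m => [|m [y yP]].
  (* The empty union does not cover, so [X] has a point to fill every index. *)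
  have [//|x _] := avoid [::].
  exists (fun=> x) => B B0 _.
  suff -> : B = set0 by rewrite /indep /vspan big_set0 mxrank0 cards0.
  by apply/setP => k; rewrite inE; apply/negP => /B0.
have [|x xP] := avoid [seq vspan (f \o y) B |
    B : {set 'I_n} in [set B : {set 'I_n} | #|B| < d]%N].
  move=> A /fintype.imageP[B]; rewrite inE => Bd ->.
  exact: leq_ltn_trans (rank_vspan _ _) Bd.
pose y' (k : 'I_n) := if val k == m then x else y k.
have indepy' (B : {set 'I_n}) : (forall k, k \in B -> (k < m)%N) ->
    (#|B| <= d)%N -> indep (f \o y') B /\ vspan (f \o y') B = vspan (f \o y) B.
  move=> Bm Bd; have E : vspan (f \o y') B = vspan (f \o y) B.
    by apply: eq_vspan => k /Bm km; rewrite /= /y' ltn_eqF.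
  by split=> //; rewrite /indep E; apply: yP.
exists y' => B Bm Bd.
(* If [B] contains the new index, the rest of [B] is old and the new vector lies outside its span;
   otherwise all of [B] is old. *)
have [/existsP[l /andP[lB /eqP lm]]|noM] := boolP [exists l : 'I_n, (l \in B) && (val l == m)].
  have Blm k : k \in B :\ l -> (k < m)%N.
    rewrite !inE => /andP[kl /Bm]; rewrite ltnS leq_eqVlt => /orP[/eqP km|//].
    by case/eqP: kl; apply: val_inj; rewrite /= km.
  have Bld : (#|B :\ l| < d)%N by move: Bd; rewrite (cardsD1 l B) lB.
  have [indBl spanBl] := indepy' _ Blm (ltnW Bld).
  rewrite -(setD1K lB); apply: indepU1 => //.
  rewrite spanBl /= /y' lm eqxx; apply: xP; apply/fintype.imageP.
  by exists (B :\ l) => //; rewrite inE.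
apply: (indepy' B _ Bd).1 => k kB; have := Bm k kB; rewrite ltnS leq_eqVlt.
by case/orP => // km; case/existsP: noM; exists k; rewrite kB.
Qed.

Lemma pigeonhole_subspace (X : Type) (F : fieldType) (d n : nat) (v : 'I_n -> 'rV[F]_d)
    (s : seq 'M[F]_d) : (size s * d < n)%N ->
  (forall k, exists2 A, A \in s & (v k <= A)%MS) ->
  exists2 A, A \in s & exists2 D : {set 'I_n}, #|D| = d & forall k, k \in D -> (v k <= A)%MS.
Proof.
move=> sn sv.
have [A As Ad] : exists2 A, A \in s & (d <= #|[set k | (v k <= A)%MS]|)%N.
  apply: contrapT => noA; move: sn; rewrite ltnNge => /negP; apply.
  (* Double counting of the pairs of an index and a subspace containing its vector: each index
     occurs at least once. *)
  apply: (@leq_trans (\sum_(A <- s) #|[set k | (v k <= A)%MS]|)%N).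
    under eq_bigr do rewrite cardsE -sum1_card big_mkcond.
    rewrite exchange_big /= -{1}(card_ord n) -sum1_card leq_sum // => k _.
    have [A As vA] := sv k.
    by rewrite (big_rem A) //= -topredE /= vA.
  rewrite -sum1_size big_distrl /= !big_seq leq_sum // => A As.
  by rewrite mul1n leqNgt; apply/negP => dA; apply: noA; exists A => //; apply: ltnW.
exists A => //; exists [set k in take d (enum [set k | (v k <= A)%MS])].
  rewrite cardsE (card_uniqP _) ?take_uniq ?enum_uniq //.
  by rewrite size_takel // -cardE.
by move=> k; rewrite inE => /mem_take; rewrite mem_enum inE.
Qed.

(** * From level-balanced trees to zero patterns and back *)

Lemma num_well_labeled_le (X : Type) (F : fieldType) (d n : nat) (f : X -> 'rV[F]_d)
    (T : labeled_tree (zero_sets f) n) : level_balanced T ->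
  exists y : 'I_n -> X, (num_well_labeled T <= #|zero_patterns (f \o y)|)%N.
Proof.
(* By balance any string of length [k] gives the same label; the all-false one is a choice. *)
move=> balT; exists (fun k => node T (k := k) [ffun=> false]).
have inj : injective (fun tau : {ffun 'I_n -> bool} => [set k | tau k]).
  by move=> t1 t2 /setP E; apply/ffunP => k; have := E k; rewrite !inE.
rewrite /num_well_labeled -(card_imset _ inj).
apply/subset_leq_card/fintype.subsetP => _ /imsetP[tau + ->]; rewrite !inE => /asboolP wl.
apply/asboolP; have [a a0 aE] := leaf_in T tau; exists a => // k.
by have := wl k; rewrite aE (balT k _ [ffun=> false]) inE.
Qed.

Lemma num_well_labeled_ge (X : Type) (F : fieldType) (d n : nat) (f : X -> 'rV[F]_d)
    (y : 'I_n -> X) : (0 < d)%N ->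
  exists2 T : labeled_tree (zero_sets f) n,
    level_balanced T & (#|zero_patterns (f \o y)| <= num_well_labeled T)%N.
Proof.
move=> d0.
have a0 : const_mx 1 != 0 :> 'rV[F]_d.
  by apply/eqP => /matrixP/(_ 0 (Ordinal d0))/eqP; rewrite !mxE oner_eq0.
have /choice[a aP] (tau : {ffun 'I_n -> bool}) : exists a : 'rV[F]_d, a != 0 /\
    ([set k | tau k] \in zero_patterns (f \o y) ->
     forall k, dotv a (f (y k)) = 0 <-> tau k).
  have [|nz] := boolP ([set k | tau k] \in zero_patterns (f \o y)).
    rewrite inE => /asboolP[a az aE]; exists a; split=> // _ k.
    by have := aE k; rewrite inE.
  (* Strings that are not patterns still need a leaf in the class, so they get a default nonzero
     vector. *)
  by exists (const_mx 1).
have leafP tau : zero_sets f (zero_set f (a tau)).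
  by exists (a tau) => //; case: (aP tau).
exists (LabeledTree (fun k _ => y k) leafP) => //.
pose g (S : {set 'I_n}) : {ffun 'I_n -> bool} := [ffun k => k \in S].
have inj : injective g.
  by move=> S1 S2 /ffunP E; apply/setP => k; have := E k; rewrite !ffunE.
rewrite -(card_imset _ inj); apply/subset_leq_card/fintype.subsetP => _ /imsetP[S Sz ->].
rewrite inE; apply/asboolP => k /=.
have [_] := aP (g S); apply.
by suff -> : [set k | g S k] = S by []; apply/setP => j; rewrite inE ffunE.
Qed.

(** Every tree is seen by the bounded maximum, since its count never exceeds the number of
    leaves. *)
Lemma vc_shatter_leP (X : Type) (C : set (set X)) (n b : nat) :
  (vc_shatter C n <= b)%N <->
  forall T : labeled_tree C n, level_balanced T -> (num_well_labeled T <= b)%N.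
Proof.
split=> [vcb T balT|Tb].
  apply: leq_trans vcb.
  have Tlt : (num_well_labeled T < #|{: {ffun 'I_n -> bool}}|.+1)%N by rewrite ltnS max_card.
  apply: (@leq_bigmax_cond _ _ (fun m : 'I__ => m : nat) (Ordinal Tlt)).
  by apply/asboolP; exists T.
by apply/bigmax_leqP => m /asboolP[T [balT <-]]; apply: Tb.
Qed.

Theorem theorem5p6 (X : Type) (F : fieldType) (d : nat) (hd : (2 <= d)%N)
    (f : X -> 'rV[F]_d) :
  maximal_of_VC_dim (zero_sets f) (d - 1) <->
  ~ in_finite_union_of_proper_subspaces f.
Proof.
have d0 : (0 < d)%N by apply: leq_trans hd.
have binomE n : binom_le n (d - 1) = #|[set B : {set 'I_n} | #|B| < d]%N|.
  by rewrite card_set_lt card_ord /binom_le subn1 prednK.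
split=> [maxC /in_finite_unionP[s [rs sP]]|finf n _].
  (* Large enough both for the pigeonhole, since [d > 0], and for maximality to apply, since
     [d - 1 <= n]. *)
  pose n := (size s * d + d)%N.
  have : (binom_le n (d - 1) <= (binom_le n (d - 1)).-1)%N.
    rewrite -{1}maxC; last by rewrite /n; lia.
    apply/vc_shatter_leP => T balT; have [y yT] := num_well_labeled_le balT.
    apply: leq_trans yT _.
    have [||A As [D Dd DA]] := @pigeonhole_subspace X F d n (f \o y) s.
    - by rewrite /n; lia.
    - by move=> k; apply: sP.
    by have := card_zero_patterns_lt hd Dd (rs A As) DA; rewrite binomE; lia.
  (* Positivity, from the term [i = 0], is what makes the bound by the predecessor absurd. *)
  have : (0 < binom_le n (d - 1))%N by rewrite /binom_le big_nat_recl // bin0.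
  by case: binom_le => // b _; rewrite /= ltnn.
apply/eqP; rewrite eqn_leq binomE; apply/andP; split.
  apply/vc_shatter_leP => T balT; have [y yT] := num_well_labeled_le balT.
  apply: leq_trans yT _; apply: card_zero_patterns_le => B _ Bd.
  by exists B => //; rewrite inE.
have [y yP] := ex_general_position n d0 finf.
have [T balT yT] := num_well_labeled_ge f y d0.
apply: leq_trans (proj1 (vc_shatter_leP _ _ _) (leqnn _) T balT).
apply: leq_trans yT; apply/subset_leq_card/fintype.subsetP => S; rewrite inE => Sd.
by apply: zero_patterns_general => // p; apply: ex_nonroot hd finf.
Qed.
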